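(* Let $y_{11},y_{21},y_{22}$ be integers with $y_{11}\geq 0$ and $y_{22}\geq 0$, and let $X$ be the standardized abelian Cayley graph with Heuberger matrix \[\begin{pmatrix} y_{11} & 0\\ y_{21} & y_{22}\end{pmatrix}.\] Let $d=\gcd(y_{11},y_{21})$ and $e=\gcd(y_{11},y_{21},y_{22})$. Then: (1) If either (i) $y_{22}=1$, or (ii) $y_{11}=1$ and $y_{22}\mid y_{21}$, or (iii) $y_{11}=0$ and $\gcd(y_{21},y_{22})=1$, then $X$ has loops and is not properly colorable. (2) If both $y_{11}+y_{21}$ and $y_{22}$ are even, then $\chi(X)=2$. (3) If neither the condition of (1) nor the condition of (2) holds, and if $y_{11}=0$ or $y_{22}=0$ or $e>1$ or $y_{22}\mid y_{21}$, then $\chi(X)=3$. (4) Suppose none of the conditions in (1), (2), (3) holds. Then there exists $q\in\mathbb{Z}$ with $\gcd(y_{11},y_{21}+qy_{22})=1$; indeed one can take $q$ to be the product of all primes $p$ such that $p\mid y_{11}$ but $p\nmid d$ (with $q=1$ if there are no such primes). For any such $q$, $\chi(X)=\chi(C_n(a,b))$, where $a=-y_{21}-qy_{22}$, $b=y_{11}$, and $n=y_{11}y_{22}$.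
   Context: For an $m\times r$ integer matrix $M$, let $H\subseteq\mathbb{Z}^m$ be the subgroup generated by the columns of $M$, let $e_1,\dots,e_m$ be the standard basis of $\mathbb{Z}^m$, and let $S=\{H\pm e_1,\dots,H\pm e_m\}\subseteq \mathbb{Z}^m/H$. The standardized abelian Cayley graph with (associated) Heuberger matrix $M$ is the Cayley graph $\mathrm{Cay}(\mathbb{Z}^m/H,S)$: its vertices are the elements of $\mathbb{Z}^m/H$, and $x,y$ are adjacent if and only if $y-x\in S$. It has loops if and only if $e_j\in H$ for some $j$. $\chi$ denotes the chromatic number (a graph with loops has no proper coloring). By convention $0\mid a$ iff $a=0$, and $\gcd(0,0)=0$. For integers $a,b,n$ with $n\neq 0$, $\gcd(a,b,n)=1$, $n\nmid a$ and $n\nmid b$, $C_n(a,b)$ denotes the Heuberger circulant $\mathrm{Cay}(\mathbb{Z}_n,\{\pm a,\pm b\})$, where $\mathbb{Z}_n=\mathbb{Z}/n\mathbb{Z}$. *)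

(* Defs.v *)
From HB Require Import structures.
From mathcomp Require Import all_boot all_order all_algebra.
From mathcomp Require Import boolp classical_sets.
Set Implicit Arguments.
Unset Strict Implicit.
Unset Printing Implicit Defensive.
Import Order.TTheory GRing.Theory Num.Theory.
Local Open Scope ring_scope.
Local Open Scope quotient_scope.
Local Open Scope classical_set_scope.

(* Possibly infinite graphs, in which loops are allowed. *)
Record graph := Graph { vertex : Type; adj : vertex -> vertex -> Prop }.

Definition has_loop (X : graph) : Prop := exists x : vertex X, adj x x.

Definition proper_coloring (X : graph) (C : Type) (f : vertex X -> C) : Prop :=
  forall x y : vertex X, adj x y -> f x <> f y.

Definition properly_colorable (X : graph) : Prop :=
  exists (C : Type) (f : vertex X -> C), proper_coloring f.

Definition colorable (X : graph) (k : nat) : Prop :=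
  exists f : vertex X -> 'I_k, proper_coloring f.

(* None when no finite number of colors suffices, e.g. when X has a loop. *)
Definition chromatic_number (X : graph) : option nat :=
  match pselect (exists k, `[< colorable X k >]) with
  | left h => Some (ex_minn h)
  | right _ => None
  end.

Definition cayley (G : zmodType) (S : set G) : graph :=
  @Graph G (fun x y => S (y - x)).

(* The subgroup of Z^m generated by the columns of M. *)
Definition column_subgroup m r (M : 'M[int]_(m, r)) : {pred 'cV[int]_m} :=
  fun v => `[< exists c : 'cV[int]_r, v = M *m c >].

Fact column_subgroup_closed m r (M : 'M[int]_(m, r)) :
  zmod_closed (column_subgroup M).
Proof.
split; first by apply/asboolP; exists 0; rewrite mulmx0.
move=> _ _ /asboolP[c ->] /asboolP[c' ->].
by apply/asboolP; exists (c - c'); rewrite mulmxBr.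
Qed.

HB.instance Definition _ m r (M : 'M[int]_(m, r)) :=
  GRing.isZmodClosed.Build 'cV[int]_m (column_subgroup M)
    (column_subgroup_closed M).

Definition column_quotient m r (M : 'M[int]_(m, r)) : zmodType :=
  {ideal_quot (column_subgroup M)}.

Definition standard_generators m r (M : 'M[int]_(m, r)) :
    set (column_quotient M) :=
  [set s | exists j : 'I_m,
     s = \pi_({ideal_quot (column_subgroup M)}) (delta_mx j 0) \/
     s = \pi_({ideal_quot (column_subgroup M)}) (- delta_mx j 0)].

(* The standardized abelian Cayley graph with Heuberger matrix M. *)
Definition heuberger_graph m r (M : 'M[int]_(m, r)) : graph :=
  cayley (@standard_generators m r M).

Definition mx22 (a b c d : int) : 'M[int]_2 :=
  \matrix_(i < 2, j < 2)
    if i == 0 then (if j == 0 then a else b) else (if j == 0 then c else d).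

(* nZ as a subgroup of Z; dvdz n is the predicate "is a multiple of n". *)
Definition multiples (n : int) : zmodClosed int :=
  GRing.ZmodClosed.clone int (dvdz n) _.

Definition Zmod (n : int) : zmodType := {ideal_quot (multiples n)}.

Definition Zmod_pi (n a : int) : Zmod n :=
  \pi_({ideal_quot (multiples n)}) a.

(* The parameters for which C_n(a,b) is a Heuberger circulant. *)
Definition circulant_params (n a b : int) : Prop :=
  [/\ n != 0, gcdz (gcdz a b) n = 1, ~~ (n %| a)%Z & ~~ (n %| b)%Z].

Definition circulant (n a b : int) : graph :=
  cayley [set s : Zmod n | [\/ s = Zmod_pi n a, s = - Zmod_pi n a,
                               s = Zmod_pi n b | s = - Zmod_pi n b]].

(* Main.v *)
(** Colorings of [X] are the [H]-periodic colorings of the lattice [Z^2].  A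
    proper [n]-periodic coloring of the path [Z] by [Z/3] exists as soon as
    [|n| != 1].  Pulling it back along [x + y] or [x - y], or adding two such
    colorings of the coordinates [x] and [y], gives all the 3-colorings; when
    [y22 = 0] the two pullbacks fail simultaneously only if [X] has a loop.  A
    2-coloring of [Z^2] must alternate, so that its periods have even
    coordinate sum.  In the last case [X] is isomorphic to the circulant. *)
Require Import Defs.
From mathcomp Require Import all_boot all_order all_algebra.
From mathcomp Require Import boolp zify ring.
Import Order.TTheory GRing.Theory Num.Theory.
Local Open Scope ring_scope.

(** * Chromatic numbers *)

Lemma colorable_leq (X : graph) (j k : nat) :
  (j <= k)%N -> colorable X j -> colorable X k.
Proof.
move=> jk [f f_proper]; exists (fun x => widen_ord jk (f x)) => x y xy fxy.
by apply: (f_proper x y xy); apply/val_inj/(congr1 val fxy).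
Qed.

Lemma chromatic_number_colorable (X : graph) (k : nat) :
  colorable X k -> exists n, chromatic_number X = Some n.
Proof.
move=> Xk; rewrite /chromatic_number; case: pselect => [h|[]]; first by eexists.
by exists k; apply/asboolP.
Qed.

Lemma chromatic_numberS (X : graph) (k : nat) :
  colorable X k.+1 -> ~ colorable X k -> chromatic_number X = Some k.+1.
Proof.
move=> XSk nXk; rewrite /chromatic_number.
case: pselect => [h|[]]; last by exists k.+1; apply/asboolP.
case: ex_minnP => n /asboolP Xn n_min; congr Some; apply/eqP.
rewrite eqn_leq n_min ?ltnNge; last exact/asboolP.
by apply/negP => nk; apply: nXk; apply: colorable_leq Xn.
Qed.

Lemma eq_chromatic_number (X Y : graph) :
  (forall k, colorable X k <-> colorable Y k) ->
  chromatic_number X = chromatic_number Y.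
Proof.
(* [ex_minn] depends on the existence proof, so [chi] abstracts the whole [match] over the
   predicate; equality of the predicates then suffices. *)
move=> XY; pose chi (P : pred nat) :=
  if pselect (exists k, P k) is left h then Some (ex_minn h) else None.
apply: (congr1 chi (_ : (fun k => `[< colorable X k >]) = _)).
by apply/funext => k; apply: asbool_equiv_eq.
Qed.

Lemma loop_not_properly_colorable (X : graph) :
  has_loop X -> ~ properly_colorable X.
Proof. by move=> [x xx] [C [f f_proper]]; apply: (f_proper x x xx). Qed.

(** * Colorings and loops of Cayley graphs of quotient groups *)

Section Quotient.
Local Open Scope quotient_scope.

(** One direction composes with the projection, the other with [repr], which changes the argument
    only by an element of [I]. One generator from each opposite pair is enough in [T], because an
    edge can be read from either endpoint. *)
Lemma colorable_cayley_quot (V : zmodType) (I : zmodClosed V)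
    (S : {ideal_quot I} -> Prop) (T : V -> Prop) (k : nat) :
  (forall s, S s <-> exists2 t, T t & s = \pi_({ideal_quot I}) t \/
                                      s = - \pi_({ideal_quot I}) t) ->
  colorable (cayley S) k <->
  exists f : V -> 'I_k, (forall v h, h \in I -> f (v + h) = f v) /\
                        (forall v t, T t -> f (v + t) <> f v).
Proof.
move=> ST; split=> [[f f_proper]|[f [fI f_proper]]].
  exists (fun v => f (\pi_({ideal_quot I}) v)); split=> [v h hI|v t Tt].
    by congr f; apply/eqP; rewrite -Quotient.idealrBE addrC addKr.
  apply/nesym/f_proper => /=; apply/ST; exists t => //.
  by left; rewrite raddfD /= addrC addKr.
have f_repr v : f (repr (\pi_({ideal_quot I}) v)) = f v.
  rewrite -[in LHS](subrK v (repr _)) addrC fI //.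
  by rewrite Quotient.idealrBE reprK.
have f_reprD (x : {ideal_quot I}) t :
    f (repr (x + \pi_({ideal_quot I}) t)) = f (repr x + t).
  by rewrite -{1}(reprK x) -raddfD /= f_repr.
exists (fun x : {ideal_quot I} => f (repr x)) => x y /= /ST [t Tt] [] e.
  by rewrite -(subrK x y) e addrC f_reprD; apply/nesym/f_proper.
by rewrite -(subKr y x) e opprK f_reprD; apply: f_proper.
Qed.

Lemma heuberger_loop m r (M : 'M[int]_(m, r)) (j : 'I_m) :
  delta_mx j 0 \in column_subgroup M -> has_loop (heuberger_graph M).
Proof.
move=> Mj; exists (0 : column_quotient M); exists j; left.
have /eqP -> : delta_mx j 0 == 0 %[mod {ideal_quot (column_subgroup M)}].
  by rewrite -Quotient.idealrBE subr0.
by apply: etrans (subrr _) (esym _); exact: raddf0.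
Qed.

End Quotient.

(** * Coordinates: periodic colorings of the lattice and of the integers *)

Definition col2 (x y : int) : 'cV[int]_2 := \col_i (if i == 0 then x else y).

Lemma col2_eta (v : 'cV[int]_2) : v = col2 (v 0 0) (v 1 0).
Proof.
apply/colP => i; rewrite mxE; case: eqP => [-> //|].
case: i => [[|[|i]] p] //; first by case; apply: val_inj.
by move=> _; congr (fun_of_matrix v _ _); apply: val_inj.
Qed.

Lemma col2D x y x' y' : col2 x y + col2 x' y' = col2 (x + x') (y + y').
Proof. by apply/colP => i; rewrite !mxE; case: ifP. Qed.

Lemma delta_col2 (j : 'I_2) :
  delta_mx j 0 = if j == 0 then col2 1 0 else col2 0 1.
Proof.
by apply/colP => i; case: j i => [[|[|j]] p] [[|[|i]] q] //; rewrite !mxE /= ?mxE.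
Qed.

Lemma column_subgroup22 (y11 y21 y22 x y : int) :
  reflect (exists s t, x = y11 * s /\ y = y21 * s + y22 * t)
    (col2 x y \in column_subgroup (mx22 y11 0 y21 y22)).
Proof.
have E s t : mx22 y11 0 y21 y22 *m col2 s t = col2 (y11 * s) (y21 * s + y22 * t).
  apply/colP => i; rewrite !mxE !big_ord_recl big_ord0 !mxE /= addr0.
  by case: ifP => //; rewrite mul0r addr0.
apply: (iffP (asboolP _)) => [[c]|[s [t [-> ->]]]]; last by exists (col2 s t).
rewrite (col2_eta c) E => e; exists (c 0 0), (c 1 0).
by have := congr1 (fun v : 'cV_2 => v 0 0) e;
   have := congr1 (fun v : 'cV_2 => v 1 0) e; rewrite !mxE.
Qed.

Lemma colorable_heuberger22 (y11 y21 y22 : int) (k : nat) :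
  colorable (heuberger_graph (mx22 y11 0 y21 y22)) k <->
  exists F : int -> int -> 'I_k,
    [/\ forall x y s t, F (x + y11 * s) (y + (y21 * s + y22 * t)) = F x y,
        forall x y, F (x + 1) y <> F x y
      & forall x y, F x (y + 1) <> F x y].
Proof.
apply: iff_trans (colorable_cayley_quot _ _ _
  (fun v => exists j : 'I_2, v = delta_mx j 0) _ _) _.
  move=> s; split=> [[j]|[_ [j ->] ?]].
    by rewrite raddfN => ?; exists (delta_mx j 0) => //; exists j.
  by exists j; rewrite raddfN.
split=> [[f [fI f_proper]]|[F [FI F1 F2]]].
  exists (fun x y => f (col2 x y)); split=> [x y s t|x y|x y].
  - by rewrite -col2D fI //; apply/column_subgroup22; exists s, t.
  - have := f_proper (col2 x y) (col2 1 0); rewrite col2D addr0; apply.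
    by exists 0; rewrite delta_col2.
  - have := f_proper (col2 x y) (col2 0 1); rewrite col2D addr0; apply.
    by exists 1; rewrite delta_col2.
exists (fun v : 'cV[int]_2 => F (v 0 0) (v 1 0)); split=> [v h|v _ [j ->]].
  rewrite (col2_eta h) => /column_subgroup22 [s [t [hx hy]]].
  by rewrite !mxE /= hx hy FI.
by rewrite delta_col2; case: ifP => _; rewrite !mxE /= addr0.
Qed.

Lemma colorable_circulant (n a b : int) (k : nat) :
  colorable (circulant n a b) k <->
  exists G : int -> 'I_k,
    [/\ forall x s, G (x + n * s) = G x,
        forall x, G (x + a) <> G x & forall x, G (x + b) <> G x].
Proof.
apply: iff_trans (colorable_cayley_quot _ (multiples n) _
  (fun t => t = a \/ t = b) _ _) _.
  move=> s; split; first by case=> ->; [exists a|exists a|exists b|exists b]; auto.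
  case=> t [] -> [] ->; [exact: Or41|exact: Or42|exact: Or43|exact: Or44].
split=> [[G [GI G_proper]]|[G [GI Ga Gb]]]; exists G.
  by split=> [x s|x|x]; [rewrite GI //; exact: dvdz_mulr|apply: G_proper; auto..].
split=> [x h|x t [] -> //].
by move=> /dvdzP [s ->]; rewrite mulrC GI.
Qed.

(** * Three-colorings *)

(** Residues are colored by parity, except that the last one, [|n| - 1], gets color 2, which
    separates it from both its neighbors when the cycle closes up. *)
Lemma cycle_3coloring (n : int) : `|n|%N != 1%N ->
  exists c : int -> 'Z_3,
    (forall x s, c (x + n * s) = c x) /\ (forall x, c (x + 1) <> c x).
Proof.
move=> n1; pose r x := (x %% `|n|%:Z)%Z.
exists (fun x => inZp (if r x == `|n|%:Z - 1 then 2%N else `|(r x %% 2)%Z|%N)).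
split=> x.
  move=> s; suff -> : r (x + n * s) = r x by [].
  by rewrite /r !modz_abs addrC mulrC modzMDl.
move=> /(congr1 val); rewrite /= -[(Zp_trunc 3).+2]/3%N.
have : r (x + 1) = if r x == `|n|%:Z - 1 then 0 else r x + 1.
  (* For [n = 0] the residue of [x] is [x] itself, and the exceptional residue is [-1], whose
     successor is still 0. *)
  rewrite /r -modzDml; have [->|n0] := eqVneq n 0; first by rewrite !modz0; case: eqP; lia.
  have := ltz_pmod x (_ : 0 < `|n|%:Z); have := modz_ge0 x (_ : `|n|%:Z != 0).
  move=> /(_ ltac:(lia)) r0 /(_ ltac:(lia)) rn.
  case: eqP => [->|?]; first by rewrite subrK modzz.
  by rewrite modz_small //; lia.
by move: (r (x + 1)) (r x) => u v; case: eqP; case: eqP; lia.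
Qed.

(** A unit step changes exactly one of the two summands, and addition in ['Z_3] is cancellative. *)
Lemma colorable3_heuberger22_product (y11 y21 y22 m n : int) :
  `|m|%N != 1%N -> `|n|%N != 1%N ->
  (m %| y11)%Z -> (n %| y21)%Z -> (n %| y22)%Z ->
  colorable (heuberger_graph (mx22 y11 0 y21 y22)) 3.
Proof.
move=> /cycle_3coloring [f [fm f1]] /cycle_3coloring [g [gn g1]].
move=> /dvdzP [u ->] /dvdzP [v ->] /dvdzP [w ->].
apply/colorable_heuberger22; exists (fun x y => f x + g y); split=> [x y s t|x y|x y].
- have -> : u * m * s = m * (u * s) by ring.
  have -> : v * n * s + w * n * t = n * (v * s + w * t) by ring.
  by rewrite fm gn.
- by move=> /addIr; apply: f1.
- by move=> /addrI; apply: g1.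
Qed.

(** The form [x + e * y] takes the values [y11 + e * y21] and [e * y22] on the two columns, both
    multiples of [n], and moves by one at each unit step. *)
Lemma colorable3_heuberger22_sum (y11 y21 y22 n e : int) :
  `|n|%N != 1%N -> e = 1 \/ e = -1 ->
  (n %| y11 + e * y21)%Z -> (n %| y22)%Z ->
  colorable (heuberger_graph (mx22 y11 0 y21 y22)) 3.
Proof.
move=> /cycle_3coloring [f [fn f1]] e1 /dvdzP [u hu] /dvdzP [w ->].
apply/colorable_heuberger22; exists (fun x y => f (x + e * y)).
split=> [x y s t|x y|x y].
- rewrite -(fn (x + e * y) (u * s + e * w * t)); congr f.
  by rewrite (_ : y11 = u * n - e * y21) ?hu; [ring | rewrite -hu; ring].
- by rewrite addrAC; apply: f1.
- case: e1 => ->; first by rewrite !mul1r addrA; apply: f1.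
  (* For [e = -1] a step in [y] goes backwards along the path. *)
  rewrite !mulN1r opprD addrA => fe; apply: (f1 (x - y - 1)).
  by rewrite subrK fe.
Qed.

(** * Two-colorings *)

Lemma heuberger22_not_2colorable (y11 y21 y22 : int) :
  colorable (heuberger_graph (mx22 y11 0 y21 y22)) 2 ->
  (2 %| y11 + y21)%Z /\ (2 %| y22)%Z.
Proof.
move=> /colorable_heuberger22 [F [FI F1 F2]].
(* With the two colors read in ['Z_2], to change color is to add 1. *)
have alternate (G : int -> 'Z_2) : (forall x, G (x + 1) <> G x) ->
    forall x, G x = G 0 + x%:~R.
  move=> G1; have GS x : G (x + 1) = G x + 1.
    have := G1 x; case: (G x) (G (x + 1)) => [[|[|i]] p] [[|[|j]] q] //= ne.
    - by case: ne; apply: val_inj.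
    - exact: val_inj.
    - exact: val_inj.
    - by case: ne; apply: val_inj.
  elim/int_rect => [|n IHn|n IHn]; first by rewrite addr0.
    by rewrite intS addrC GS IHn rmorphD addrA.
  apply: (addIr 1); rewrite -GS.
  have -> : - n.+1%:Z + 1 = - n%:Z by lia.
  rewrite IHn -addrA; congr (_ + _).
  by rewrite -[1 in RHS]/(1%:~R) -rmorphD; congr _%:~R; lia.
have FE x y : F x y = F 0 0 + (x + y)%:~R :> 'Z_2.
  by rewrite (alternate (F x) (F2 x)) (alternate (F^~ 0)) // -addrA -rmorphD.
have even z : F 0 0 = F 0 0 + z%:~R :> 'Z_2 -> (2 %| z)%Z.
  rewrite -{1}[F 0 0]addr0 => /addrI; rewrite {1}(divz_eq z 2) rmorphD rmorphM /=.
  have -> : 2%:~R = 0 :> 'Z_2 by apply: val_inj.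
  rewrite mulr0 add0r; have := ltz_pmod z (_ : 0 < 2) => /(_ isT).
  have := modz_ge0 z (_ : 2 != 0) => /(_ isT).
  move=> z0 z2 e; apply/dvdz_mod0P; move: (z %% 2)%Z z0 z2 e.
  by case=> [[|[|i]]|i].
split; apply: even.
  by apply: etrans (FE y11 y21); rewrite -(FI 0 0 1 0); congr F; ring.
rewrite -[y22 in RHS]add0r; apply: etrans (FE 0 y22).
by rewrite -(FI 0 0 0 1); congr F; ring.
Qed.

(** * Comparison with the circulant and choice of [q] *)

(* Adding [q] times the second column to the first, the Bezout coefficients of
   [y11] and [y21 + q * y22] give an inverse of the map [(x, y) |-> a x + b y]
   from [Z^2 / H] to [Z / n]. *)
Lemma colorable_heuberger22_circulant (y11 y21 y22 q : int) (k : nat) :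
  gcdz y11 (y21 + q * y22) = 1 ->
  colorable (heuberger_graph (mx22 y11 0 y21 y22)) k <->
  colorable (circulant (y11 * y22) (- y21 - q * y22) y11) k.
Proof.
move=> g1; have [v [u uv1]] := Bezoutz y11 (y21 + q * y22).
split=> [/colorable_heuberger22 [F [FI F1 F2]]|/colorable_circulant [G [GI Ga Gb]]].
  apply/colorable_circulant; exists (fun z => F (- u * z) (v * z)).
  split=> [z s|z|z].
  - rewrite -(FI (- u * z) (v * z) (- u * y22 * s) (v * y11 * s + y21 * u * s)).
    by congr F; ring.
  (* By Bezout, [a * (-u, v)] differs from the first basis vector by [-v] times the modified first
     column [(y11, y21 + q * y22)]; likewise [b * (-u, v)] from the second by [-u] times that
     column. *)
  - move=> e; apply: (F1 (- u * z) (v * z)); rewrite -{}e.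
    rewrite -(FI (- u * z + 1) (v * z) (- v) (- v * q)) -g1 -uv1.
    by congr F; ring.
  - move=> e; apply: (F2 (- u * z) (v * z)); rewrite -{}e.
    rewrite -(FI (- u * z) (v * z + 1) (- u) (- u * q)) -g1 -uv1.
    by congr F; ring.
apply/colorable_heuberger22.
exists (fun x y => G ((- y21 - q * y22) * x + y11 * y)); split=> [x y s t|x y|x y].
- rewrite -(GI ((- y21 - q * y22) * x + y11 * y) (t - q * s)).
  by congr G; ring.
- by rewrite mulrDr mulr1 addrAC; apply: Ga.
- by rewrite mulrDr mulr1 addrA; apply: Gb.
Qed.

(** Each residue gets its own color. This makes the chromatic number of the circulant an actual
    [Some k]; the successor form of [|n|] is what [inord] requires. *)
Lemma circulant_colorable (n a b : int) :
  circulant_params n a b -> colorable (circulant n a b) `|n|%N.-1.+1.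
Proof.
case=> n0 _ na nb; apply/colorable_circulant.
have step c x : ~~ (n %| c)%Z ->
    inord `|((x + c) %% n)%Z|%N <> inord `|(x %% n)%Z|%N :> 'I_(`|n|%N.-1.+1).
  move=> /negP nc /(congr1 val) /=.
  have lt_n y : (`|(y %% n)%Z|%N < `|n|%N.-1.+1)%N.
    by have := ltz_mod y n0; have := modz_ge0 y n0; lia.
  rewrite !inordK // => e; apply: nc.
  have /eqP : ((x + c) %% n)%Z = (x %% n)%Z.
    by have := modz_ge0 x n0; have := modz_ge0 (x + c) n0; lia.
  by rewrite eqz_mod_dvd addrC addKr.
exists (fun x => inord `|(x %% n)%Z|%N); split=> [x s|x|x]; try exact: step.
by rewrite addrC mulrC modzMDl.
Qed.

Lemma gcdz_prime_divisor (m n : int) :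
  m != 0 -> (forall p : nat, prime p -> (p%:Z %| m)%Z -> (p%:Z %| n)%Z -> False) ->
  gcdz m n = 1.
Proof.
move=> m0 np; suff : `|gcdz m n|%N = 1%N by rewrite /gcdz /=; lia.
apply/eqP; apply/negPn/negP => g1.
have p_pr : prime (pdiv `|gcdz m n|%N).
  apply: pdiv_prime; rewrite ltn_neqAle eq_sym g1 absz_gt0 gcdz_eq0.
  by rewrite (negPf m0).
have : ((pdiv `|gcdz m n|%N)%:Z %| gcdz m n)%Z by rewrite dvdzE pdiv_dvd.
by rewrite dvdz_gcd => /andP[]; apply: np.
Qed.

Lemma dvdz_primeM (p : nat) (m n : int) :
  prime p -> (p%:Z %| m * n)%Z = (p%:Z %| m)%Z || (p%:Z %| n)%Z.
Proof. by move=> p_pr; rewrite !dvdzE abszM Euclid_dvdM. Qed.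

(** Let a prime [p] divide [a]. If [p] divides [b], it divides neither [c] nor the product, hence
    not the sum. Otherwise [p] is a factor of the product and does not divide [b]. *)
Lemma gcdz_shift_prod_primes (a b c : int) :
  a != 0 -> gcdz (gcdz a b) c = 1 ->
  gcdz a (b + (\prod_(p <- primes `|a|%N | ~~ (p%:Z %| gcdz a b)%Z) p%:Z) * c) = 1.
Proof.
move=> a0 e1; apply: gcdz_prime_divisor => // p p_pr pa.
have p_in : p \in primes `|a|%N by rewrite mem_primes p_pr absz_gt0 a0.
have np1 : (p%:Z %| 1)%Z = false by rewrite dvdz1; case: p p_pr {pa p_in} => [|[]].
have [pd|npd] := boolP (p%:Z %| gcdz a b)%Z.
  have := pd; rewrite dvdz_gcd => /andP[_ pb]; rewrite (rpredDl _ pb) dvdz_primeM //.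
  case/orP=> [|pc]; last first.
    have : (p%:Z %| gcdz (gcdz a b) c)%Z by rewrite dvdz_gcd pd.
    by rewrite e1 np1.
  apply/negP; rewrite big_seq_cond; elim/big_rec: _ => [|r m]; first by rewrite np1.
  rewrite dvdz_primeM // negb_or mem_primes => /andP[/and3P[r_pr _ _] nrd] ->.
  by rewrite andbT dvdzE !absz_nat dvdn_prime2 //; apply: contraNneq nrd => <-.
rewrite (big_rem p) //= npd -mulrA rpredDr ?dvdz_mulr // => pb.
by move: npd; rewrite dvdz_gcd pa pb.
Qed.

Theorem theorem2p9 (y11 y21 y22 : int) (hy11 : 0 <= y11) (hy22 : 0 <= y22) :
  let X := heuberger_graph (mx22 y11 0
                                 y21 y22) in
  let d := gcdz y11 y21 in
  let e := gcdz (gcdz y11 y21) y22 in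
  let cond1 := [\/ y22 = 1, y11 = 1 /\ (y22 %| y21)%Z
                 | y11 = 0 /\ gcdz y21 y22 = 1] in
  let cond2 := (2 %| y11 + y21)%Z /\ (2 %| y22)%Z in
  let cond3 := [\/ y11 = 0, y22 = 0, 1 < e | (y22 %| y21)%Z] in
  let q0 : int := \prod_(p <- primes `|y11|%N | ~~ (p%:Z %| d)%Z) p%:Z in
  [/\ cond1 -> has_loop X /\ ~ properly_colorable X,
      cond2 -> chromatic_number X = Some 2%N,
      ~ cond1 -> ~ cond2 -> cond3 -> chromatic_number X = Some 3%N
    & ~ cond1 -> ~ cond2 -> ~ cond3 ->
      [/\ exists q : int, gcdz y11 (y21 + q * y22) = 1,
          gcdz y11 (y21 + q0 * y22) = 1
        & forall q : int, gcdz y11 (y21 + q * y22) = 1 ->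
          let a := - y21 - q * y22 in
          let b := y11 in
          let n := y11 * y22 in
          circulant_params n a b /\
          exists k : nat, chromatic_number X = Some k /\
                          chromatic_number (circulant n a b) = Some k]].
Proof.
move=> X d e cond1 cond2 cond3 q0; split=> [c1|[ev1 ev2]|nc1 nc2 c3|nc1 nc2 nc3].
- suff hl : has_loop X by split=> //; apply: loop_not_properly_colorable.
  (* The basis vector found in the column subgroup is the second, the first and the second,
     respectively. *)
  case: c1 => [h|[h1 /dvdzP [w hw]]|[h g1]].
  + apply: (@heuberger_loop _ _ _ 1); rewrite delta_col2; apply/column_subgroup22.
    by exists 0, 1; rewrite h; split; ring.
  + apply: (@heuberger_loop _ _ _ 0); rewrite delta_col2; apply/column_subgroup22.
    by exists 1, (- w); rewrite h1 hw; split; ring.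
  + apply: (@heuberger_loop _ _ _ 1); rewrite delta_col2; apply/column_subgroup22.
    have [u [v uv]] := Bezoutz y21 y22.
    by exists u, v; rewrite h -g1 -uv; split; ring.
- apply: chromatic_numberS.
    have two0 : 2%:~R = 0 :> 'Z_2 by apply: val_inj.
    have step (x : int) : (x + 1)%:~R <> x%:~R :> 'Z_2.
      by rewrite rmorphD -[RHS]addr0 => /addrI.
    have even (x y : int) : (2 %| y)%Z -> (x + y)%:~R = x%:~R :> 'Z_2.
      by case/dvdzP=> z ->; rewrite rmorphD rmorphM /= two0 mulr0 addr0.
    apply/colorable_heuberger22; exists (fun x y => (x + y)%:~R : 'Z_2).
    split=> [x y s t|x y|x y].
    + rewrite -(even (x + y) ((y11 + y21) * s + y22 * t)).
        by congr _%:~R; ring.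
      by rewrite rpredD ?dvdz_mulr.
    + by rewrite addrAC; apply: step.
    + by rewrite addrA; apply: step.
  case/colorable_heuberger22=> F [_ F1 _].
  by apply: (F1 0 0); rewrite !ord1.
- apply: chromatic_numberS; last by move=> /heuberger22_not_2colorable.
  case: c3 => h.
  (* Here [y11 = 0], so [x] needs no period, and condition (iii) is what fails when the gcd is not
     1. *)
  + apply: (@colorable3_heuberger22_product _ _ _ 0 (gcdz y21 y22)) => //.
    * by apply/eqP => g1; apply: nc1; apply: Or33; split=> //; rewrite -[LHS]gez0_abs // g1.
    * by rewrite h.
    * exact: dvdz_gcdl.
    * exact: dvdz_gcdr.
  (* If both [y11 + y21] and [y11 - y21] are units, one of [y11], [y21] is 0 and the other a unit,
     which gives a loop by (iii) or (ii). *)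
  + have [s1|s1] := eqVneq `|(y11 + y21)%R|%N 1%N; last first.
      by apply: (colorable3_heuberger22_sum _ _ _ _ 1 s1 (or_introl erefl));
         rewrite ?mul1r ?h.
    have [s2|s2] := eqVneq `|(y11 - y21)%R|%N 1%N; last first.
      by apply: (colorable3_heuberger22_sum _ _ _ _ (-1) s2 (or_intror erefl));
         rewrite ?mulN1r ?h.
    case: nc1; have [y0|y0] := eqVneq y11 0.
      by apply: Or33; split=> //; rewrite h gcdz0; lia.
    by apply: Or32; rewrite h dvd0z; split; [|apply/eqP]; lia.
  + have e1 : `|e|%N != 1%N by lia.
    apply: (colorable3_heuberger22_product _ _ _ _ _ e1 e1).
    * exact: dvdz_trans (dvdz_gcdl _ _) (dvdz_gcdl _ _).
    * exact: dvdz_trans (dvdz_gcdl _ _) (dvdz_gcdr _ _).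
    * exact: dvdz_gcdr.
  (* Since [y22] divides [y21], the values [y11 = 1] and [y22 = 1] are excluded by (ii) and (i). *)
  + apply: (@colorable3_heuberger22_product _ _ _ y11 y22) => //.
      by apply/eqP => y1; apply: nc1; apply: Or32; split=> //; lia.
    by apply/eqP => y1; apply: nc1; apply: Or31; lia.
- have y11_neq0 : y11 != 0 by apply/eqP => h; apply: nc3; apply: Or41.
  have y22_neq0 : y22 != 0 by apply/eqP => h; apply: nc3; apply: Or42.
  have e1 : e = 1.
    have : e <> 0 by move/eqP; rewrite !gcdz_eq0 (negPf y11_neq0).
    have : ~ 1 < e by move=> h; apply: nc3; apply: Or43.
    have : 0 <= e by [].
    by move: (e) => -[[|[]]|].
  have gq0 := gcdz_shift_prod_primes _ _ _ y11_neq0 e1.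
  split=> // [|q gq a b n]; first by exists q0.
  have params : circulant_params n a b.
    split.
    + by rewrite mulf_neq0.
    + have -> : a = - (y21 + q * y22) by rewrite /a; ring.
      by rewrite gcdNz [gcdz _ b]gcdzC gq gcd1z.
    (* As [y22] divides [n], it would divide [a], hence [y21]. *)
    + apply/negP => na; apply: nc3; apply: Or44.
      have := dvdz_trans (dvdz_mull y11 (dvdzz y22)) na.
      by rewrite /a -opprD rpredN rpredDr ?dvdz_mull.
    + rewrite /n /b -{1}[y11]mulr1 dvdz_mul2l //.
      by apply/negP; rewrite dvdz1 => y1; apply: nc1; apply: Or31; lia.
  have [k Ck] := chromatic_number_colorable _ _ (circulant_colorable _ _ _ params).
  split=> //; exists k; split=> //; rewrite -Ck; apply: eq_chromatic_number => j.
  exact: colorable_heuberger22_circulant.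
Qed.
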